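(* Let $m\ge 1$ and let $p(x)=\sum_{\alpha\in\mathbb{N}^2,\,|\alpha|\le m}p_\alpha x^\alpha\in\mathbb{R}[x_1,x_2]$ be a bivariate real polynomial of total degree $m$ with $p(0)=1$. Let $H(z)$ be the Hermite matrix of $p$, i.e. the $m\times m$ symmetric matrix of Laurent polynomials in $z$ defined in the context. Then $p$ is rigidly convex if and only if $H(z)$ is positive semidefinite for every $z\in\mathbb{C}$ with $|z|=1$. Moreover, the coefficients of (the Laurent polynomial entries of) $H(z)$ are explicit polynomial expressions in the coefficients $p_\alpha$ of $p$.
   Context: Rigid convexity: a polynomial $p\in\mathbb{R}[x_1,x_2]$ of degree $m$ with $p(0)=1$ is called rigidly convex (equivalently, the connected component containing the origin of $\{x\in\mathbb{R}^2: p(x)\ge 0\}$ is called rigidly convex) if $p$ satisfies the real zero condition: for every unit vector $v\in\mathbb{R}^2$, the univariate polynomial $s\mapsto p(s v)$ has only real roots. The Hermite matrix of $p$: substitute $x_1=t^{-1}(z^{-1}+z)$, $x_2=i\,t^{-1}(z^{-1}-z)$ (for $z=e^{i\theta}$ and $t=2r^{-1}$ this is $x_1=r\cos\theta$, $x_2=r\sin\theta$) and set $$q(t)=t^m p(x)=\sum_{k=0}^m q_k(z)\,t^k .$$ This is a monic polynomial of degree $m$ in $t$ (since $q_m(z)=p(0)=1$) whose coefficients $q_k(z)$ are Laurent polynomials in $z$ that take real values when $|z|=1$. Let $N_k$ denote the $k$-th Newton sum of $q$ with respect to $t$, that is, $N_k=\sum_{j=1}^m t_j^k$ where $t_1,\dots,t_m$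 are the roots of $q(t)$ counted with multiplicity (equivalently $N_k=\mathrm{trace}\,C^k$ with $C$ a companion matrix of $q(t)$); $N_k$ is a polynomial in the coefficients $q_0(z),\dots,q_{m-1}(z)$, hence a Laurent polynomial in $z$. The Hermite matrix is the Hankel matrix $H(z)=(N_{i+j})_{0\le i,j\le m-1}$. *)

(* Defs.v *)
From HB Require Import structures.
From mathcomp Require Import all_boot all_order all_algebra.
From mathcomp Require Import sesquilinear spectral.
From mathcomp Require Import reals.
From mathcomp Require Import complex mpoly.
Set Implicit Arguments.
Unset Strict Implicit.
Unset Printing Implicit Defensive.
Import Order.TTheory GRing.Theory Num.Theory.
Local Open Scope ring_scope.
Local Open Scope complex_scope.
Local Open Scope sesquilinear_scope.

Section Defs.
Variable R : realType.
Local Notation C := R[i].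

(* The univariate polynomial s |-> p (s v). *)
Definition line_restr (p : {mpoly R[2]}) (v : 'rV[R]_2) : {poly R} :=
  mmap polyC (fun i => v ord0 i *: 'X) p.

(* The real zero condition: all complex roots of s |-> p (s v) are real. *)
Definition rigidly_convex (p : {mpoly R[2]}) : Prop :=
  forall v : 'rV[R]_2, v ord0 ord0 ^+ 2 + v ord0 ord_max ^+ 2 = 1 ->
  forall s : C, root (map_poly (real_complex R) (line_restr p v)) s ->
  exists x : R, s = x%:C.

Definition psdmx (n : nat) (A : 'M[C]_n) : Prop :=
  A \is hermsymmx /\ forall u : 'rV[C]_n, 0 <= (u *m A *m u ^t*) ord0 ord0.

(* q(t) = t^m p(x) with x_1 = t^-1 (z^-1 + z), x_2 = i t^-1 (z^-1 - z),
   expanded monomial by monomial; the exponent m - |a| is a genuine difference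
   as soon as m bounds the degree of p. *)
Definition hermite_poly (m : nat) (p : {mpoly R[2]}) (z : C) : {poly C} :=
  \sum_(a <- msupp p)
    ((p@_a)%:C * (z^-1 + z) ^+ a ord0 * ('i * (z^-1 - z)) ^+ a ord_max)
      *: 'X^(m - mdeg a).

(* The roots of q in the algebraically closed field C, with multiplicity. *)
Definition croots (q : {poly C}) : seq C := sval (closed_field_poly_normal q).

Definition newton_sum (q : {poly C}) (k : nat) : C :=
  \sum_(t <- croots q) t ^+ k.

Definition hermite_mx (m : nat) (p : {mpoly R[2]}) (z : C) : 'M[C]_m :=
  \matrix_(i, j) newton_sum (hermite_poly m p z) (i + j).

(* Polynomial expressions in the coefficients (p_a), |a| <= m: polynomials in
   one indeterminate per exponent a, to be evaluated at coef_val m p. *)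
Local Notation coef_ring m := {mpoly C[#|{: 'X_{1..2 < m.+1}}|]}.

Definition coef_var (m : nat) (a : 'X_{1..2 < m.+1}) : coef_ring m :=
  'X_(enum_rank a).

Definition coef_val (m : nat) (p : {mpoly R[2]})
    (k : 'I_#|{: 'X_{1..2 < m.+1}}|) : C :=
  (p@_(bmnm (enum_val k)))%:C.

(* z^d times the coefficient of t^(m-d) in q(t), as a polynomial in z (the
   variable 'X) whose coefficients are expressions in the p_a; multiplying by
   z^d turns z^-1 + z and z^-1 - z into 1 + z^2 and 1 - z^2. *)
Definition gen_coef (m d : nat) : {poly coef_ring m} :=
  \sum_(a : 'X_{1..2 < m.+1} | mdeg a == d)
    (coef_var a)%:P * (1 + 'X^2) ^+ (bmnm a ord0)
                    * (('i)%:MP%:P * (1 - 'X^2)) ^+ (bmnm a ord_max).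

(* [:: z^k N_k; ...; z N_1; N_0] from Newton's identities
   N_k + c_1 N_(k-1) + ... + c_(k-1) N_1 + k c_k = 0,
   where c_d is the coefficient of t^(m-d) in q (c_d = 0 for d > m). *)
Fixpoint gen_newtons (m k : nat) : seq {poly coef_ring m} :=
  if k is k'.+1 then
    let s := gen_newtons m k' in
    (- (gen_coef m k *+ k) - \sum_(j < k') gen_coef m j.+1 * s`_j) :: s
  else [:: m%:R].

(* The coefficient of z^l in N_k, as an expression in the p_a. *)
Definition newton_coef (m k : nat) (l : int) : coef_ring m :=
  if l + k%:Z is Posz n then (head 0 (gen_newtons m k))`_n else 0.

(* The Laurent polynomial \sum_(-d <= l <= d) c_l z^l at a point z. *)
Definition laurent (d : nat) (c : int -> C) (z : C) : C :=
  \sum_(n < d.*2.+1) c (n%:Z - d%:Z) * z ^ (n%:Z - d%:Z).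

End Defs.

(* Main.v *)
Require Import Defs.
From mathcomp Require Import all_boot all_order all_algebra.
From mathcomp Require Import reals complex mpoly.
From mathcomp Require Import sesquilinear spectral ring ssrcomplements.
Set Implicit Arguments.
Unset Strict Implicit.
Unset Printing Implicit Defensive.
Import Order.TTheory GRing.Theory Num.Theory.
Local Open Scope ring_scope.

(** Two classical facts carry the proof: Hermite's criterion for real-rooted
polynomials, and Newton's identities.

Rigid convexity. On the unit circle, z = v_1 + i v_2 gives z^-1 + z = 2 v_1
and i (z^-1 - z) = 2 v_2, so q(t) = t^m p((2 / t) v) for t <> 0: the nonzero
roots of q are the numbers 2 / s with s a root of the restriction of p to the
line through v (and 0 is not such a root, since p(0) = 1).  Hence p satisfies
the real zero condition iff q has only real roots for every z on the circle
([hermite_rigid]).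

Hermite's criterion. Writing t_1, ..., t_m for the roots of q, the Hankel
matrix of their power sums satisfies
  u H u^* = \sum_k f(t_k) g(t_k),   where f = \sum_i u_i X^i
and where g has the conjugate coefficients, so that g(t) is the conjugate of
f evaluated at the conjugate of t ([hankel_form]).  If the roots are real,
this is a sum of squared moduli.  If t_0 is a nonreal root, its conjugate is
also a root because q is real; the polynomial f that is 1 at t_0, -1 at the
conjugate of t_0 and 0 at the other roots has degree < m, and every nonzero
term of the sum is then 1 * (-1) ([hankel_negative]).

Laurent coefficients. The coefficient of t^(m - d) in q is a form of degree d
in z^-1 + z and i (z^-1 - z), so multiplication by z^d turns it into a
polynomial of degree at most 2d in z with coefficients in the p_a
([eval_gen_coef]).  Newton's identities ([newton_identity]) compute the power
sums from these coefficients by a recursion that respects this weight, so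
z^k N_k is a polynomial in z of degree at most 2k ([gen_newtonsP]), which is
the claimed Laurent expansion of N_k. *)

(** * Hermite's criterion *)

Definition power_sum (R : nzRingType) (s : seq R) (k : nat) : R :=
  \sum_(t <- s) t ^+ k.

(** The Hankel matrix is the sum over the roots t of the rank one matrices
(t^i t^j), and each of these contributes one product to the form. *)
Lemma hankel_form (C : numClosedFieldType) (n : nat) (s : seq C)
    (u : 'rV[C]_n) :
  (u *m (\matrix_(i, j) power_sum s (i + j)) *m u ^t*%sesqui) ord0 ord0
  = \sum_(t <- s) (\sum_i u ord0 i * t ^+ i) * (\sum_j (u ord0 j)^* * t ^+ j).
Proof.
rewrite mxE; under eq_bigr => j _ do rewrite !mxE mulr_suml.
under eq_bigr => j _ do under eq_bigr => i _
  do rewrite mxE mulr_sumr mulr_suml.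
rewrite exchange_big /=; under eq_bigr => i _ do rewrite exchange_big /=.
rewrite exchange_big /=; apply: eq_bigr => t _.
rewrite mulr_suml; apply: eq_bigr => i _.
rewrite mulr_sumr; apply: eq_bigr => j _.
by rewrite exprD -!mulrA; congr (_ * (_ * _)); rewrite mulrC.
Qed.

Lemma hankel_psd (C : numClosedFieldType) (n : nat) (s : seq C) (u : 'rV[C]_n) :
  all (fun t => t \is Num.real) s ->
  0 <= (u *m (\matrix_(i, j) power_sum s (i + j)) *m u ^t*%sesqui) ord0 ord0.
Proof.
move=> /allP s_real; rewrite hankel_form big_seq sumr_ge0 // => t /s_real t_real.
have -> : \sum_j (u ord0 j)^* * t ^+ j = (\sum_j u ord0 j * t ^+ j)^*.
  rewrite rmorph_sum; apply: eq_bigr => j _.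
  by rewrite rmorphM rmorphXn /= (CrealP t_real).
exact: mul_conjC_ge0.
Qed.

(** The vector u lists the coefficients of an interpolating polynomial f with
f = 1 at t0, f = -1 at its conjugate and f = 0 at the other roots.  At least
two entries of s are spared by the product over the other roots, which leaves
room for a linear factor and explains why n coefficients suffice. *)
Lemma hankel_negative (C : numClosedFieldType) (n : nat) (s : seq C) (t0 : C) :
  (size s <= n)%N -> t0 \in s -> t0^* \in s -> t0^* != t0 ->
  exists u : 'rV[C]_n,
    (u *m (\matrix_(i, j) power_sum s (i + j)) *m u ^t*%sesqui) ord0 ord0 < 0.
Proof.
move=> le_sn t0s t1s t10; set t1 := t0^*.
pose s' := [seq t <- s | (t != t0) && (t != t1)].
pose A := \prod_(t <- s') ('X - t%:P).
have AN0 t : (t == t0) || (t == t1) -> A.[t] != 0.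
  move=> tt; rewrite -[_ != 0]/(~~ root A t) root_prod_XsubC mem_filter.
  by rewrite -negb_or tt.
have D0 : t1 - t0 != 0 by rewrite subr_eq0.
(* L is the line through (t0, 1 / A(t0)) and (t1, - 1 / A(t1)). *)
pose b := (- A.[t1]^-1 - A.[t0]^-1) / (t1 - t0).
pose L := (A.[t0]^-1)%:P + b *: ('X - t0%:P).
pose f := A * L.
have f0 : f.[t0] = 1.
  by rewrite !(hornerE, hornerZ) subrr mulr0 addr0 mulfV // AN0 ?eqxx.
have f1 : f.[t1] = -1.
  rewrite !(hornerE, hornerZ) /b divfK // addrCA subrr addr0 mulrN mulfV //.
  by rewrite AN0 ?eqxx ?orbT.
have size_s' : (size s' + 2 <= size s)%N.
  have -> : size s' = count (predC (pred2 t0 t1)) s.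
    by rewrite size_filter; apply: eq_count => t /=; rewrite negb_or.
  rewrite -(count_predC (pred2 t0 t1) s) addnC leq_add2r.
  have := count_predUI (pred1 t0) (pred1 t1) s.
  rewrite [count (predI _ _) s](_ : _ = 0%N); last first.
    apply/eqP; rewrite -leqn0 leqNgt -has_count; apply/hasPn => t _ /=.
    by apply/negP => /andP[/eqP->] /eqP/esym/eqP; apply/negP.
  rewrite addn0 => countU.
  rewrite [X in (_ <= X)%N](_ : _ = count (predU (pred1 t0) (pred1 t1)) s) //.
  by rewrite countU; apply: (@leq_add 1 1); rewrite -has_count has_pred1.
have size_L : (size L <= 2)%N.
  rewrite (leq_trans (size_polyD _ _)) // geq_max.
  rewrite (leq_trans (size_polyC_leq1 _)) //.
  by rewrite (leq_trans (size_scale_leq _ _)) // size_XsubC.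
have size_f : (size f <= n)%N.
  rewrite (leq_trans (size_polyMleq _ _)) // size_prod_XsubC /=.
  by rewrite (leq_trans _ le_sn) // (leq_trans _ size_s') // leq_add2l.
pose u : 'rV[C]_n := \row_i f`_i.
have uf t : \sum_i u ord0 i * t ^+ i = f.[t].
  by rewrite (horner_coef_wide _ size_f); apply: eq_bigr => i _; rewrite mxE.
have uf' t : \sum_i (u ord0 i)^* * t ^+ i = (f.[t^*])^*.
  rewrite -uf rmorph_sum; apply: eq_bigr => i _.
  by rewrite rmorphM rmorphXn /= conjCK.
(* The terms of the form are -1 at t0 and t1, and 0 elsewhere. *)
exists u.
rewrite hankel_form (eq_big_seq (fun t => - ((t == t0) || (t == t1))%:R)).
  rewrite sumrN oppr_lt0 lt_neqAle sumr_ge0 ?andbT; last first.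
    by move=> t _; case: (_ || _).
  rewrite eq_sym; apply/eqP => /eqP; rewrite psumr_eq0 => [|t _]; last first.
    by case: (_ || _).
  by move=> /allP/(_ _ t0s); rewrite eqxx /= oner_eq0.
move=> t ts; rewrite uf uf'.
case: (eqVneq t t0) => [->|tt0] /=; first by rewrite f0 -/t1 f1 mul1r rmorphN1.
case: (eqVneq t t1) => [->|tt1] /=.
  by rewrite /t1 conjCK f0 f1 rmorph1 mulr1.
have -> : f.[t] = 0; last by rewrite mul0r oppr0.
apply/eqP; rewrite hornerM mulf_eq0 -[_.[t] == 0]/(root A t) root_prod_XsubC.
by rewrite mem_filter tt0 tt1 ts.
Qed.


(** * Newton's identities *)

(** For Q = \prod (1 - t X), the logarithmic derivative of Q is
- \sum_k N_(k+1) X^k as a formal power series.  Truncating at X^n and clearing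
the denominator, the error is a multiple of X^n; B is its cofactor.  Each new
root adds a truncated geometric series. *)
Lemma newton_series (R : comNzRingType) (s : seq R) (n : nat) :
  let Q := \prod_(t <- s) (1 - t *: 'X) in
  exists B, Q^`() + Q * \sum_(k < n) power_sum s k.+1 *: 'X^k = B * 'X^n.
Proof.
elim: s => [|t s [B IH]] /=.
  exists 0; rewrite big_nil derivC add0r mul1r mul0r.
  by rewrite big1 // => k _; rewrite /power_sum big_nil scale0r.
rewrite big_cons; set Q := \prod_(_ <- s) _ in IH *.
exists ((1 - t *: 'X) * B - t ^+ n.+1 *: Q).
have -> : \sum_(k < n) power_sum (t :: s) k.+1 *: 'X^k
  = t *: \sum_(k < n) (t *: 'X) ^+ k + \sum_(k < n) power_sum s k.+1 *: 'X^k.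
  rewrite scaler_sumr -big_split; apply: eq_bigr => k _.
  by rewrite /power_sum big_cons scalerDl exprZn scalerA -exprS.
have geom : (1 - t *: 'X) * (t *: \sum_(k < n) (t *: 'X) ^+ k)
    = t%:P - t ^+ n.+1 *: 'X^n.
  rewrite -scalerAr -opprB mulNr -subrX1 opprB exprZn scalerBr scalerA -exprS.
  by rewrite -[t *: 1]mul_polyC mulr1.
rewrite derivM derivB derivC derivZ derivX sub0r (mulrDr (_ * Q)).
rewrite (mulrAC _ Q) geom -!mul_polyC mulr1 in IH *.
rewrite [RHS]mulrBl -(mulrA _ B) -IH.
ring.
Qed.

(** Comparison of the coefficients of X^k in [newton_series] with n = k + 1.
The Q used here is the reversed polynomial of \prod (X - t), so its
coefficients vanish beyond the number of roots: the same formula covers the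
cases k < size s and k >= size s. *)
Lemma newton_identity (R : comNzRingType) (s : seq R) (k : nat) :
  let Q := \prod_(t <- s) (1 - t *: 'X) in
  power_sum s k.+1
  = - (Q`_k.+1 *+ k.+1) - \sum_(j < k) Q`_j.+1 * power_sum s (k - j).
Proof.
move=> Q; have [B /(congr1 (fun f : {poly R} => f`_k))] := newton_series s k.+1.
rewrite -/Q coefD coef_deriv coefMXn ltnSn coefM.
rewrite -(poly_def _ (fun i => power_sum s i.+1)).
under eq_bigr => j _ do rewrite coef_poly ltnS leq_subr.
have Q0 : Q`_0 = 1.
  rewrite -horner_coef0 horner_prod big1 // => t _.
  by rewrite !hornerE subr0.
rewrite big_ord_recl Q0 mul1r subn0 => /eqP.
rewrite addrCA addr_eq0 opprD => /eqP->.
congr (_ - _); apply: eq_bigr => j _.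
by rewrite lift0 subnSK.
Qed.

Lemma coef_prod_rev (R : comNzRingType) (s : seq R) (d : nat) :
  (\prod_(t <- s) (1 - t *: 'X))`_d
  = if (d <= size s)%N then (\prod_(t <- s) ('X - t%:P))`_(size s - d) else 0.
Proof.
elim: s d => [|t s IH] d; first by rewrite !big_nil !coef1; case: d.
rewrite !big_cons !mulrBl mul1r -scalerAl !coefB coefZ coefXM coefCM coefXM /=.
rewrite !IH; case: d => [|d].
  rewrite !subn0 mulr0 subr0 /= [X in _ - _ * X]nth_default ?mulr0 ?subr0 //.
  by rewrite size_prod_XsubC.
rewrite /= ltnS subSS; case: (ltngtP d (size s)) => [ltd|gtd|->].
- by rewrite subn_eq0 leqNgt ltd /= subnS.
- by rewrite mulr0 subr0.
- by rewrite subnn eqxx.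
Qed.

Local Open Scope complex_scope.

(** * The polynomial q and the restrictions of p to lines *)

(** The coefficient of t^(m - d) in q: the degree d part of p evaluated at
(z^-1 + z, i (z^-1 - z)).  Indexing by d instead of m - d makes it independent
of m and meaningful, as 0, for d > m. *)
Definition hermite_coef (R : realType) (p : {mpoly R[2]}) (z : R[i]) (d : nat)
  : R[i] :=
  \sum_(a <- msupp p | mdeg a == d)
    (p@_a)%:C * (z^-1 + z) ^+ a ord0 * ('i * (z^-1 - z)) ^+ a ord_max.

Lemma prod_ord2 (S : pzSemiRingType) (F : 'I_2 -> S) :
  \prod_(i < 2) F i = F ord0 * F ord_max.
Proof. by rewrite big_ord_recr big_ord1 /=; congr (F _ * _); apply: val_inj. Qed.

Lemma mdeg2 (a : 'X_{1..2}) : mdeg a = (a ord0 + a ord_max)%N.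
Proof.
by rewrite mdegE big_ord_recr big_ord1; congr (a _ + _)%N; apply: val_inj.
Qed.

Lemma coef_hermite_poly (R : realType) (m d : nat) (p : {mpoly R[2]}) (z : R[i]) :
  msize p = m.+1 -> (d <= m)%N ->
  (hermite_poly m p z)`_(m - d) = hermite_coef p z d.
Proof.
move=> deg_p le_dm; rewrite coef_sum [RHS]big_mkcond !big_seq.
apply: eq_bigr => a /msize_mdeg_lt; rewrite deg_p ltnS => le_am.
rewrite coefZ coefXn (_ : (m - d == m - mdeg a) = (mdeg a == d))%N.
  by case: eqP; rewrite ?mulr1 ?mulr0.
by rewrite eqn_sub2lE // eq_sym.
Qed.

Lemma hermite_coef0 (R : realType) (p : {mpoly R[2]}) (z : R[i]) :
  p.@[fun=> 0] = 1 -> hermite_coef p z 0 = 1.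
Proof.
move=> p0; rewrite -[RHS](rmorph1 (real_complex R)) -p0 mevalE rmorph_sum.
rewrite [LHS]big_mkcond; apply: eq_bigr => a _.
rewrite rmorphM; case: eqP => [/eqP|a_gt0].
  by rewrite mdeg_eq0 => /eqP ->; rewrite prod_ord2 !mnm0E !expr0 !mulr1.
rewrite prod_ord2 -exprD -mdeg2 expr0n.
by case: eqP a_gt0 => // _; rewrite mulr0.
Qed.

Lemma hermite_coef_gt (R : realType) (m d : nat) (p : {mpoly R[2]}) (z : R[i]) :
  msize p = m.+1 -> (m < d)%N -> hermite_coef p z d = 0.
Proof.
move=> deg_p lt_md; rewrite /hermite_coef big_seq_cond big1 // => a.
move=> /andP[/msize_mdeg_lt]; rewrite deg_p ltnS => le_am /eqP ad.
by move: lt_md; rewrite -ad ltnNge le_am.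
Qed.

Lemma hermite_poly_roots (R : realType) (m : nat) (p : {mpoly R[2]}) (z : R[i]) :
  msize p = m.+1 -> p.@[fun=> 0] = 1 ->
  size (croots (hermite_poly m p z)) = m /\
  hermite_poly m p z = \prod_(t <- croots (hermite_poly m p z)) ('X - t%:P).
Proof.
move=> deg_p p0; set q := hermite_poly m p z.
have qm : q`_m = 1 by rewrite -(subn0 m) coef_hermite_poly // hermite_coef0.
have size_q : size q = m.+1.
  apply/eqP; rewrite eqn_leq; apply/andP; split; last first.
    rewrite ltnNge; apply/negP => le_qm.
    by move/eqP: qm; rewrite nth_default // eq_sym oner_eq0.
  apply: (leq_trans (size_sum _ _ _)); apply/bigmax_leqP_seq => a _ _.
  rewrite (leq_trans (size_scale_leq _ _)) // size_polyXn ltnS leq_subr //.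
have lead_q : lead_coef q = 1 by rewrite lead_coefE size_q.
have E : q = \prod_(t <- croots q) ('X - t%:P).
  rewrite /croots; case: closed_field_poly_normal => r /= {1}->.
  by rewrite lead_q scale1r.
by split=> //; apply/eqP; rewrite -eqSS -size_q {2}E size_prod_XsubC.
Qed.

Lemma coef_prod_hermite (R : realType) (m d : nat) (p : {mpoly R[2]}) (z : R[i]) :
  msize p = m.+1 -> p.@[fun=> 0] = 1 ->
  (\prod_(t <- croots (hermite_poly m p z)) (1 - t *: 'X))`_d
    = hermite_coef p z d.
Proof.
move=> deg_p p0; have [size_r E] := hermite_poly_roots z deg_p p0.
rewrite coef_prod_rev -E size_r; case: leqP => [le_dm|lt_md].
  exact: coef_hermite_poly.
by rewrite (hermite_coef_gt _ deg_p).
Qed.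

Lemma horner_line_restr (R : realType) (p : {mpoly R[2]}) (v : 'rV[R]_2) (s : R[i]) :
  (map_poly (real_complex R) (line_restr p v)).[s]
  = \sum_(a <- msupp p) (p@_a)%:C * (v ord0 ord0)%:C ^+ a ord0
       * (v ord0 ord_max)%:C ^+ a ord_max * s ^+ mdeg a.
Proof.
rewrite rmorph_sum horner_sum; apply: eq_bigr => a _.
rewrite rmorphM hornerM /= map_polyC hornerC /mmap1 prod_ord2.
rewrite rmorphM !rmorphXn /= !map_polyZ map_polyX.
rewrite hornerM !horner_exp !hornerZ hornerX !exprMn mdeg2 exprD.
by rewrite [X in _ * X = _]mulrACA !mulrA.
Qed.

(** The factor 2 in z^-1 + z and i (z^-1 - z) is absorbed in the parameter of
the line: q(t) = t^m p((2 / t) v). *)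
Lemma horner_hermite_poly (R : realType) (m : nat) (p : {mpoly R[2]})
    (v : 'rV[R]_2) (z t : R[i]) :
  msize p = m.+1 -> t != 0 ->
  z^-1 + z = 2 * (v ord0 ord0)%:C -> 'i * (z^-1 - z) = 2 * (v ord0 ord_max)%:C ->
  (hermite_poly m p z).[t]
  = t ^+ m * (map_poly (real_complex R) (line_restr p v)).[2 / t].
Proof.
move=> deg_p t0 zx zy; rewrite horner_line_restr mulr_sumr horner_sum !big_seq.
apply: eq_bigr => a /msize_mdeg_lt; rewrite deg_p ltnS => le_am.
rewrite hornerZ hornerXn zx zy expfB_cond; last by rewrite (negPf t0).
have -> : (2 / t) ^+ mdeg a = 2 ^+ a ord0 * 2 ^+ a ord_max / t ^+ mdeg a.
  by rewrite exprMn exprVn mdeg2 !exprD.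
by rewrite !exprMn; ring.
Qed.

(** On the unit circle z^-1 is the conjugate of z, so z^-1 + z and
i (z^-1 - z) are real and q has real coefficients. *)
Lemma hermite_poly_conj (R : realType) (m : nat) (p : {mpoly R[2]}) (z t : R[i]) :
  `|z| = 1 -> (hermite_poly m p z).[t^*%R] = ((hermite_poly m p z).[t])^*%R.
Proof.
move=> z1; have zV : z^-1 = z^*%R by rewrite invC_norm z1 expr1n invr1 mul1r.
rewrite -horner_map; congr (_.[_]); rewrite rmorph_sum; apply: eq_bigr => a _ /=.
rewrite map_polyZ map_polyXn !rmorphM !rmorphXn /=; congr (_ *: _).
rewrite rmorphM rmorphD rmorphB /= zV !conjCK conjCi.
have -> : (p@_a)%:C^*%R = (p@_a)%:C.
  by apply/CrealP/complex_realP; exists p@_a.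
by rewrite addrC mulNr -mulrN opprB.
Qed.

(** The parametrization of unit vectors v by z = v_1 + i v_2 is a bijection with
the unit circle, and t |-> 2 / t matches the nonzero roots of q with the roots
of the restriction of p to the line through v.  A root t = 0 of q, which
corresponds to a drop of degree of that restriction, is real anyway. *)
Lemma hermite_rigid (R : realType) (m : nat) (p : {mpoly R[2]}) :
  msize p = m.+1 -> p.@[fun=> 0] = 1 ->
  rigidly_convex p <->
  forall z t : R[i], `|z| = 1 -> root (hermite_poly m p z) t -> t \is Num.real.
Proof.
move=> deg_p p0; have two0 : (2 : R[i]) != 0 by rewrite pnatr_eq0.
split=> [rc z t z1 | real_roots v v1 s].
  have zV : z^-1 = z^*%R by rewrite invC_norm z1 expr1n invr1 mul1r.
  case: (eqVneq t 0) => [-> //|t0].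
  have [x xE] : exists x : R, z^-1 + z = 2 * x%:C.
    have /complex_realP[x xE] := Creal_Re z.
    by exists x; rewrite -xE ReE mulrC divfK // zV addrC.
  have [y yE] : exists y : R, 'i * (z^-1 - z) = 2 * y%:C.
    have /complex_realP[y yE] := Creal_Im z.
    by exists y; rewrite -yE ImE [RHS]mulrC divfK // zV.
  pose v : 'rV[R]_2 := \row_i if i == ord0 then x else y.
  have v0 : v ord0 ord0 = x by rewrite mxE.
  have v1 : v ord0 ord_max = y by rewrite mxE.
  rewrite /root (@horner_hermite_poly _ _ _ v _ _ deg_p t0); rewrite ?v0 ?v1 //.
  rewrite mulf_eq0 (negPf (expf_neq0 _ t0)) /= => rt.
  have norm_v : v ord0 ord0 ^+ 2 + v ord0 ord_max ^+ 2 = 1.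
    rewrite v0 v1; apply: (@complexI R); apply: (mulfI (expf_neq0 2 two0)).
    rewrite rmorphD !rmorphXn mulrDr -!exprMn -xE -yE exprMn sqrCi rmorph1.
    have zzV : z^-1 * z = 1 by rewrite mulVf // -normr_eq0 z1 oner_eq0.
    rewrite sqrrD sqrrB zzV; ring.
  have [w wE] := rc v norm_v _ rt.
  have -> : t = 2 / w%:C by rewrite -wE invf_div mulrC divfK.
  by apply/complex_realP; exists (2 / w); rewrite rmorphM fmorphV rmorph_nat.
case: (eqVneq s 0) => [-> _|s0 rs]; first by exists 0.
set x := v ord0 ord0 in v1; set y := v ord0 ord_max in v1.
pose z : R[i] := x%:C + 'i * y%:C.
have conj_real (w : R) : (w%:C)^*%R = w%:C.
  by apply/CrealP/complex_realP; exists w.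
have zC : z^*%R = x%:C - 'i * y%:C.
  by rewrite rmorphD rmorphM /= !conj_real conjCi mulNr.
have zz : z * z^*%R = 1.
  rewrite zC mulrC -subr_sqr exprMn sqrCi mulN1r opprK.
  by rewrite -!rmorphXn -rmorphD v1 rmorph1.
have z1 : `|z| = 1 by apply/eqP; rewrite -sqrp_eq1 // normCK zz.
have zV : z^-1 = z^*%R by rewrite invC_norm z1 expr1n invr1 mul1r.
have t0 : 2 / s != 0 by rewrite mulf_neq0 // invr_neq0.
have : root (hermite_poly m p z) (2 / s).
  rewrite /root (@horner_hermite_poly _ _ _ v _ _ deg_p t0).
  - by rewrite (_ : 2 / (2 / s) = s) ?(rootP rs) ?mulr0 // invf_div mulrC divfK.
  - by rewrite zV zC -/x /z; ring.
  rewrite zV zC -/y /z.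
  have -> : 'i * (x%:C - 'i * y%:C - (x%:C + 'i * y%:C))
            = - ('i ^+ 2) * (2 * y%:C) :> R[i].
    by ring.
  by rewrite sqrCi opprK mul1r.
move=> /(real_roots _ _ z1)/complex_realP[w wE]; exists (2 / w).
have -> : s = 2 / w%:C by rewrite -wE invf_div mulrC divfK.
by rewrite rmorphM fmorphV rmorph_nat.
Qed.

(** * Laurent expansion of the Newton sums *)

Lemma size_polyM_leq (S : nzRingType) (f g : {poly S}) (a b : nat) :
  (size f <= a.+1)%N -> (size g <= b.+1)%N -> (size (f * g)%R <= (a + b).+1)%N.
Proof.
move=> le_fa le_gb; apply: leq_trans (size_polyMleq _ _) _.
by rewrite -subn1 leq_subLR (leq_trans (leq_add le_fa le_gb)) // addSn addnS.
Qed.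

Lemma size_polyX_leq (S : nzRingType) (f : {poly S}) (a n : nat) :
  (size f <= a.+1)%N -> (size (f ^+ n)%R <= (a * n).+1)%N.
Proof.
move=> le_fa; apply: leq_trans (size_poly_exp_leq _ _) _.
by rewrite ltnS leq_mul2r -subn1 leq_subLR add1n le_fa orbT.
Qed.

Lemma size_gen_coef (R : realType) (m d : nat) :
  (size (gen_coef R m d) <= d.*2.+1)%N.
Proof.
have size2 (S : nzRingType) (c : S) : (size (1 + c *: 'X^2)%R <= 3)%N.
  rewrite (leq_trans (size_polyD _ _)) // geq_max size_poly1.
  by rewrite (leq_trans (size_scale_leq _ _)) ?size_polyXn.
apply: leq_trans (size_sum _ _ _) _; apply/bigmax_leqP => a /eqP <-.
rewrite mdeg2 doubleD -!mul2n.
apply: size_polyM_leq.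
  rewrite -[(2 * _)%N]add0n; apply: size_polyM_leq; first exact: size_polyC_leq1.
  by apply: size_polyX_leq; rewrite -['X^2]scale1r; apply: size2.
apply: size_polyX_leq; apply: (@size_polyM_leq _ _ _ 0 2).
  exact: size_polyC_leq1.
by rewrite -scaleN1r; apply: size2.
Qed.

Section GenericNewton.

Variables (R : realType) (m : nat) (p : {mpoly R[2]}) (z : R[i]).
Hypotheses (deg_p : msize p = m.+1) (p0 : p.@[fun=> 0] = 1) (z0 : z != 0).

(** Evaluation of the coefficient variables at p and of the polynomial variable
at z.  Only its values on constants and on the variable matter; keeping it
abstract also keeps it folded during simplification. *)
Variable ev : {rmorphism {poly {mpoly R[i][#|{: 'X_{1..2 < m.+1}}|]}} -> R[i]}.
Hypotheses (evC : forall c, ev c%:P = c.@[coef_val p]) (evX : ev 'X = z).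

(** Homogeneity: the d factors z in z^d are distributed over the d linear
factors of each monomial, which turns z^-1 + z into 1 + z^2 and z^-1 - z into
1 - z^2. *)
Lemma eval_gen_coef (d : nat) :
  ev (gen_coef R m d) = z ^+ d * hermite_coef p z d.
Proof.
rewrite /hermite_coef (big_mksub_cond 'X_{1..2 < m.+1}) //=; first last.
- by move=> a /msize_mdeg_lt; rewrite deg_p.
- exact: msupp_uniq.
rewrite mulr_sumr rmorph_sum big_mkcondr /=; apply: eq_bigr => a /eqP ad.
case: ifPn => [_|/memN_msupp_eq0 pa0]; last first.
  by rewrite !rmorphM evC mevalXU /coef_val enum_rankK pa0 !mul0r.
have evD : ev (1 + 'X^2) = 1 + z ^+ 2 by rewrite rmorphD rmorph1 rmorphXn evX.
have evB : ev (1 - 'X^2) = 1 - z ^+ 2 by rewrite rmorphB rmorph1 rmorphXn evX.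
have evi : ev (('i)%:MP%:P * (1 - 'X^2)) = 'i * (1 - z ^+ 2).
  by rewrite rmorphM evB evC mevalC.
rewrite !rmorphM !rmorphXn evD evi evC mevalXU /coef_val enum_rankK.
rewrite -ad mdeg2 exprD.
have -> : 1 + z ^+ 2 = z * (z^-1 + z) by rewrite mulrDr mulfV.
have -> : 1 - z ^+ 2 = z * (z^-1 - z) by rewrite mulrBr mulfV.
rewrite (mulrCA 'i z) !exprMn.
ring.
Qed.

(** Newton's recursion is homogeneous when c_d and N_d have weight d, so it
holds after multiplying both by z^d.  The size bound records that the weight k
sum has no monomials beyond z^(2k), hence that nothing is lost when the Laurent
expansion of N_k is cut at z^k. *)
Lemma gen_newtonsP (k j : nat) : (j <= k)%N ->
  (size ((gen_newtons R m k)`_j)%R <= (k - j).*2.+1)%N /\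
  ev (gen_newtons R m k)`_j
  = z ^+ (k - j) * newton_sum (hermite_poly m p z) (k - j).
Proof.
elim: k j => [|k IH] j.
  rewrite leqn0 => /eqP -> /=; split.
    by rewrite -polyC_natr size_polyC_leq1.
  rewrite rmorph_nat expr0 mul1r -[newton_sum _ _]/(power_sum _ 0) /power_sum.
  under eq_bigr => t _ do rewrite expr0.
  rewrite big_const_seq count_predT iter_addr_0.
  by have [-> _] := hermite_poly_roots z deg_p p0.
case: j => [|j]; last by rewrite ltnS subSS /=; apply: IH.
move=> _; rewrite subn0 /=; split.
  rewrite (leq_trans (size_polyD _ _)) // !size_polyN geq_max; apply/andP; split.
    rewrite -scaler_nat (leq_trans (size_scale_leq _ _)) //.
    exact: size_gen_coef.
  apply: leq_trans (size_sum _ _ _) _; apply/bigmax_leqP => i _.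
  have -> : (k.+1.*2 = i.+1.*2 + (k - i).*2)%N.
    by rewrite -doubleD addSn subnKC // ltnW.
  apply: size_polyM_leq (size_gen_coef _ _ _) _.
  by have [] := IH i (ltnW (ltn_ord i)).
rewrite rmorphB rmorphN rmorphMn eval_gen_coef -[newton_sum _ _]/(power_sum _ _).
rewrite newton_identity coef_prod_hermite // mulrBr mulrN mulrnAr; congr (_ - _).
rewrite rmorph_sum mulr_sumr; apply: eq_bigr => i _.
have [_ E] := IH i (ltnW (ltn_ord i)).
rewrite rmorphM eval_gen_coef E coef_prod_hermite //.
have -> : (k.+1 = i.+1 + (k - i))%N by rewrite addSn subnKC // ltnW.
by rewrite exprD mulrACA.
Qed.

End GenericNewton.

Lemma newton_sum_laurent (R : realType) (m : nat) (p : {mpoly R[2]}) (z : R[i])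
    (k : nat) :
  msize p = m.+1 -> p.@[fun=> 0] = 1 -> z != 0 ->
  newton_sum (hermite_poly m p z) k
  = laurent k (fun l => (newton_coef R m k l).@[coef_val (m := m) p]) z.
Proof.
move=> deg_p p0 z0.
pose ev := horner_eval z \o map_poly (meval (coef_val (m := m) p)).
have evC c : ev c%:P = c.@[coef_val p].
  by rewrite /ev /= map_polyC /horner_eval hornerC.
have evX : ev 'X = z by rewrite /ev /= map_polyX /horner_eval hornerX.
have [] := gen_newtonsP deg_p p0 z0 evC evX (leq0n k).
rewrite subn0 => size_f E.
apply: (mulfI (expf_neq0 k z0)); rewrite -E /laurent mulr_sumr /= /horner_eval.
rewrite (horner_coef_wide z (leq_trans (size_poly _ _) size_f)).
apply: eq_bigr => i _.
rewrite coef_map /newton_coef subrK /= nth0 mulrCA; congr (_ * _).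
by rewrite [z ^+ k]exprnP [LHS]exprnP -expfzDr // addrC subrK.
Qed.

(** * The theorem *)

Theorem lemma1 (R : realType) (m : nat) (m_ge1 : (1 <= m)%N)
    (p : {mpoly R[2]}) (deg_p : msize p = m.+1)
    (p0 : p.@[fun=> 0] = 1) :
  (rigidly_convex p <->
     forall z : R[i], `|z| = 1 -> psdmx (hermite_mx m p z)) /\
  (forall (i j : 'I_m) (z : R[i]), z != 0 ->
     hermite_mx m p z i j =
     laurent (i + j)
       (fun l => (newton_coef R m (i + j) l).@[coef_val (m := m) p]) z).
Proof.
split; last by move=> i j z z0; rewrite mxE newton_sum_laurent.
have HE z : hermite_mx m p z
    = \matrix_(i, j) power_sum (croots (hermite_poly m p z)) (i + j) by [].
have root_croots z t :
    root (hermite_poly m p z) t = (t \in croots (hermite_poly m p z)).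
  have [_ {1}->] := hermite_poly_roots z deg_p p0.
  by rewrite root_prod_XsubC.
rewrite (hermite_rigid deg_p p0); split=> [real_roots z z1 | psd z t z1 rt].
  have rr : all (fun t => t \is Num.real) (croots (hermite_poly m p z)).
    by apply/allP => t; rewrite -root_croots; apply: real_roots.
  split; last by move=> u; rewrite HE; apply: hankel_psd.
  apply: realsym_hermsym.
    apply/is_hermitianmxP/matrixP => i j.
    by rewrite expr0 scale1r map_mx_id // !mxE addnC.
  apply/mxOverP => i j; rewrite mxE /newton_sum big_seq rpred_sum // => t.
  move=> /(allP rr) t_real.
  exact: rpredX.
apply/negPn/negP => t_nreal.
have rt' : root (hermite_poly m p z) t^*%R.
  by rewrite /root hermite_poly_conj // (rootP rt) rmorph0.
have [size_r _] := hermite_poly_roots z deg_p p0.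
have [u] : exists u : 'rV[R[i]]_m,
    (u *m hermite_mx m p z *m u ^t*%sesqui) ord0 ord0 < 0.
  rewrite HE; apply: (@hankel_negative _ _ _ t); rewrite ?size_r -?root_croots //.
  by apply: contraNneq t_nreal => /CrealP.
have [_ /(_ u) u_ge0] := psd z z1.
by move=> /(le_lt_trans u_ge0); rewrite ltxx.
Qed.
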